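(* Let $n\ge2$ and $2\le k\le n$. Summed over all $\Pi\in S^3_n$, the total number of $k$-plateaux equals \[(n-k+1)!\,(n-k)!\left(\frac{n!}{(n-k)!}+2\sum_{\ell=k-1}^{n-2}\frac{(\ell+1)!}{(\ell+1-k)!}\right).\]
   Context: $S_n$ is the set of permutations of $\{0,\dots,n-1\}$ in one-line notation. $S^3_n$ is the set of pairs $\Pi=(\pi^2,\pi^3)$ of elements of $S_n$, with elements (columns) $\Pi_j=(\pi^2_j,\pi^3_j)^T$ and (sum) level $\mathrm{lev}(\Pi_j)=\pi^2_j+\pi^3_j$. A $k$-plateau of $\Pi$ (occurrence of the consecutive pattern $\underline{11\cdots1}$ with $k$ ones) is an index $i$ with $1\le i\le n-k+1$ such that $\mathrm{lev}(\Pi_i)=\mathrm{lev}(\Pi_{i+1})=\dots=\mathrm{lev}(\Pi_{i+k-1})$. *)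

(* Defs.v *)
From mathcomp Require Import all_boot all_fingroup.

Set Implicit Arguments.
Unset Strict Implicit.
Unset Printing Implicit Defensive.

(* S^3_n: the pair (pi^2, pi^3). *)
Notation perm3 n := ('S_n * 'S_n)%type.

Definition lev (n : nat) (Pi : perm3 n) (j : 'I_n) : nat := Pi.1 j + Pi.2 j.

(* Positions are counted from 0, so the index i here is i + 1 on paper and
   1 <= i <= n - k + 1 becomes i + k <= n. For k > 0 this bound implies i < n,
   so ranging over 'I_n loses no index. *)
Definition is_plateau (n k : nat) (Pi : perm3 n) (i : 'I_n) : bool :=
  (i + k <= n) &&
  [forall j : 'I_n, (i <= j < i + k) ==> (lev Pi j == lev Pi i)].

Definition num_plateaux (n k : nat) (Pi : perm3 n) : nat :=
  #|[set i : 'I_n | is_plateau k Pi i]|.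

(* Main.v *)
Require Import Defs.
From mathcomp Require Import all_boot all_fingroup.
From mathcomp Require Import zify.

(** Fix a window of [k] positions and a level [c].  The columns of level [c]
    are determined by their first entry, which ranges over [c + 1] values if
    [c < n] and over [2n - 1 - c] values otherwise.  A choice of [k] distinct
    such values fills the window at level [c], and each of the two partial
    injections extends to a permutation in [(n - k)!] ways.  Summing over [c]
    and over the [n - k + 1] windows gives the count. *)

Lemma perm_extension (T : finType) (s t : seq T) :
  uniq s -> uniq t -> size s = size t -> exists p : {perm T}, map p s = t.
Proof.
elim: s t => [|x s IHs] [|y t] //=; first by exists 1%g.
move=> /andP[xNs us] /andP[yNt ut] [/(IHs _ us ut)[p pst]].
(* The transposition corrects the image of [x]. It fixes every entry of [t], since neither [p x] nor
   [y] occurs there, so the images of [s] survive. *)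
exists (p * tperm (p x) y)%g; rewrite permM tpermL -pst; congr (_ :: _).
apply/eq_in_map => z zs; rewrite permM tpermD //.
  by rewrite (inj_eq perm_inj); apply: contraNneq xNs => ->.
by apply: contraNneq yNt => ->; rewrite -pst map_f.
Qed.

(** The solutions form a coset of the pointwise stabilizer of [s]: right translation by one solution
    [p0] matches them with the permutations supported off [s]. *)
Lemma card_perm_map (T : finType) (s t : seq T) :
  uniq s -> uniq t -> size s = size t ->
  #|[set p : {perm T} | map p s == t]| = (#|T| - size s)`!.
Proof.
move=> us ut st; have [p0 p0st] := perm_extension _ _ _ us ut st.
have -> : #|T| - size s = #|~: [set x in s]|.
  by rewrite cardsCs setCK cardsE (card_uniqP us).
rewrite -card_perm -[RHS](card_imset _ (mulIg p0)); apply: eq_card => p.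
apply/idP/imsetP => [|[q qs ->]].
  rewrite inE => /eqP pst; exists (p * p0^-1)%g; last by rewrite mulgKV.
  apply/subsetP => x; apply: contraNT; rewrite !inE negbK => xs.
  have /eq_in_map/(_ x xs) pp0 : map p s = map p0 s by rewrite pst.
  by rewrite permM pp0 permK.
rewrite inE -p0st; apply/eqP/eq_in_map => x xs.
by rewrite permM (out_perm qs) // !inE negbK.
Qed.

(** Group the permutations by their tuple of images of [s]. Every duplicate-free tuple over [D]
    arises from equally many of them, by [card_perm_map]. *)
Lemma card_perm_into (T : finType) (D : {pred T}) (s : seq T) : uniq s ->
  #|[set p : {perm T} | all D (map p s)]| =
  #|D| ^_ (size s) * (#|T| - size s)`!.
Proof.
move=> us; rewrite -card_uniq_tuples -sum1dep_card.
rewrite (partition_big (fun p : {perm T} => map_tuple p (in_tuple s))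
  [in [set t : (size s).-tuple T | all D t & uniq t]]) /=; last first.
  by move=> p ps; rewrite inE ps /= map_inj_uniq //; apply: perm_inj.
rewrite -sum_nat_const; apply: eq_bigr => t; rewrite inE => /andP[Dt ut].
rewrite -(card_perm_map _ s t) ?size_tuple // -sum1dep_card.
apply: eq_bigl => p; rewrite -val_eqE /=.
by apply/andb_idl => /eqP ->.
Qed.

Lemma card_ord_range (n l m : nat) : m <= n ->
  #|[pred a : 'I_n | l <= a < m]| = m - l.
Proof.
move=> mn; rewrite -sum1_card.
rewrite -(big_mkord (fun a => l <= a < m) (fun=> 1)) /=.
rewrite sum1_count -[RHS](size_iota l) -size_filter; congr size.
apply: (irr_sorted_eq ltn_trans ltnn); last first.
- by move=> a; rewrite mem_filter mem_index_iota mem_iota; lia.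
- exact: iota_ltn_sorted.
- exact/(sorted_filter ltn_trans)/iota_ltn_sorted.
Qed.

(** On [s] the values of [q] are forced to be [c - p x], which lies in ['I_n] exactly when
    [p x <= c < p x + n]. The boolean factor is 0 if this fails somewhere on [s]. *)
Lemma card_perm_complement (n c : nat) (s : seq 'I_n) (p : 'S_n) : uniq s ->
  #|[set q : 'S_n | all (fun x => p x + q x == c) s]| =
  all (fun a : 'I_n => a <= c < a + n) (map p s) * (n - size s)`!.
Proof.
move=> us; case: allP => [Dp|NDp]; last first.
  rewrite mul0n; apply/eqP; rewrite cards_eq0 -subset0; apply/subsetP => q.
  rewrite !inE => /allP Hq; case: NDp => _ /mapP[x xs ->].
  move: (Hq _ xs) => /eqP <-; rewrite leq_addr /= ltn_add2l; exact: ltn_ord.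
pose f x : 'I_n := insubd x (c - p x).
have fE x : x \in s -> p x + f x = c.
  move=> xs; have /andP[? ?] := Dp _ (map_f p xs).
  rewrite /f insubdK; rewrite ?unfold_in /=; lia.
have uf : uniq (map f s).
  rewrite map_inj_in_uniq // => x y xs ys fxy.
  by apply/(@perm_inj _ p)/val_inj/(@addIn (f x)); rewrite {2}fxy !fE.
have := card_perm_map _ s _ us uf; rewrite size_map card_ord mul1n => <- //.
apply: eq_card => q; rewrite !inE.
apply/allP/eqP => [H|/eq_in_map H x xs]; last by rewrite H // fE.
apply/eq_in_map => x xs; apply/val_inj/(@addnI (p x)).
by rewrite fE //; apply/eqP/H.
Qed.

Lemma card_level_values (n c : nat) :
  #|[pred a : 'I_n | a <= c < a + n]| =
  if c < n then c.+1 else n.*2.-1 - c.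
Proof.
case: ifP => cn.
  rewrite -[RHS]subn0 -(card_ord_range n 0 c.+1) //; apply: eq_card => a.
  rewrite !inE; lia.
have -> : n.*2.-1 - c = n - (c.+1 - n) by lia.
rewrite -(card_ord_range n) //; apply: eq_card => a; rewrite !inE.
have := ltn_ord a; lia.
Qed.

Lemma sum_level_values (n k : nat) : 0 < n -> 0 < k ->
  \sum_(c < n.*2) #|[pred a : 'I_n | a <= c < a + n]| ^_ k =
  n ^_ k + 2 * \sum_(c < n) c ^_ k.
Proof.
case: n => // n _ k0.
under eq_bigr do rewrite card_level_values.
rewrite -(big_mkord predT
  (fun c => (if c < n.+1 then c.+1 else n.+1.*2.-1 - c) ^_ k)).
(* The lower half of the levels has sizes [1] to [n.+1], the upper half sizes [n] down to [0], hence
   the reversal below. *)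
rewrite (@big_cat_nat _ _ _ n.+1) //=; last lia.
have eqn : n.+1.*2 - n.+1 = n.+1 by lia.
rewrite (big_addn 0 _ n.+1) eqn [X in _ + X]big_nat_rev /= !big_mkord.
transitivity (\sum_(c < n.+1) c.+1 ^_ k + \sum_(c < n.+1) c ^_ k).
  congr (_ + _); apply: eq_bigr => c _; first by rewrite ltn_ord.
  by congr (_ ^_ k); case: ifP; have := ltn_ord c; lia.
(* As [0 < k], a term [0 ^_ k = 0] can be put in front. Both halves then start at 0, and the lower
   one has the extra top term [n.+1 ^_ k]. *)
have <- : \sum_(c < n.+2) c ^_ k = \sum_(c < n.+1) c.+1 ^_ k.
  by rewrite big_ord_recl ffact_small // add0n.
rewrite big_ord_recr /=; lia.
Qed.

Lemma sum_ffact (n k : nat) : 0 < k -> k <= n ->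
  \sum_(c < n) c ^_ k =
  \sum_(k - 1 <= l < n - 1) (l + 1)`! %/ (l + 1 - k)`!.
Proof.
move=> k0 kn.
rewrite -(big_mkord predT (fun c => c ^_ k)) (@big_cat_nat _ _ _ k) //=.
rewrite big_nat big1 ?add0n => [|c ck]; last exact: ffact_small.
(* The terms with [c < k] are gone; the others are reindexed by [c = l + 1]. *)
have := big_addn (k - 1) n 1 predT (fun c => c ^_ k).
rewrite subnK // => ->.
by apply: eq_big_nat => l kl; rewrite ffact_factd //; lia.
Qed.

Lemma sum_is_plateau (n k : nat) (i : 'I_n) : 0 < k -> i + k <= n ->
  \sum_(Pi : perm3 n) is_plateau k Pi i =
  (n - k)`! * (n - k)`! * (n ^_ k + 2 * \sum_(c < n) c ^_ k).
Proof.
move=> k0 ikn; rewrite -sum_level_values ?(leq_ltn_trans _ (ltn_ord i)) //.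
pose w := enum [pred j : 'I_n | i <= j < i + k].
have uw : uniq w by exact: enum_uniq.
have sw : size w = k by rewrite -cardE card_ord_range // addKn.
(* Only [c = p i + q i] can contribute, because [i] lies in the window. This makes the level a
   summation index, so that for fixed [c] one counts first [q], then [p]. *)
have plateauE (p q : 'S_n) : is_plateau k (p, q) i =
    \sum_(c < n.*2) all (fun x => p x + q x == c) w :> nat.
  have iw : i \in w by rewrite mem_enum inE leqnn /=; lia.
  have lpq : p i + q i < n.*2.
    by have := ltn_ord (p i); have := ltn_ord (q i); lia.
  rewrite (bigD1 (Ordinal lpq)) //= big1 ?addn0 => [|c /negP cl]; last first.
    apply/eqP; rewrite eqb0; apply/allP => /(_ i iw) /eqP pqc.
    by case: cl; apply/eqP/val_inj.
  congr nat_of_bool; rewrite /is_plateau ikn /lev /=.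
  apply/forallP/allP => [H x|H x].
    by rewrite mem_enum; apply: (implyP (H x)).
  by apply/implyP => xw; apply: H; rewrite mem_enum.
rewrite -(pair_bigA _ (fun p q => is_plateau k (p, q) i : nat)) /=.
under eq_bigr do under eq_bigr do rewrite plateauE.
under eq_bigr do rewrite exchange_big.
rewrite exchange_big big_distrr; apply: eq_bigr => c _ /=.
transitivity (\sum_(p : 'S_n)
    all (fun a : 'I_n => a <= c < a + n) (map p w) * (n - k)`!).
  apply: eq_bigr => p _; rewrite -sw -card_perm_complement //.
  by rewrite -sum1dep_card [RHS]big_mkcond.
rewrite -big_distrl /= -big_mkcond sum1dep_card card_perm_into //.
by rewrite sw card_ord -mulnA mulnC.
Qed.

Theorem theorem4p17 (n k : nat) (hn : 2 <= n) (hk : 2 <= k) (hkn : k <= n) :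
  \sum_(Pi : perm3 n) num_plateaux k Pi =
  (n - k + 1)`! * (n - k)`! *
  (n`! %/ (n - k)`! +
   2 * \sum_(k - 1 <= l < n - 1) ((l + 1)`! %/ (l + 1 - k)`!)).
Proof.
have k0 : 0 < k by exact: ltnW.
rewrite -sum_ffact // -ffact_factd //.
under eq_bigr do rewrite /num_plateaux -sum1dep_card big_mkcond.
rewrite exchange_big (bigID (fun i : 'I_n => i + k <= n)) /=.
rewrite [X in _ + X]big1 ?addn0 => [|i /negPf ik]; last first.
  by rewrite big1 // => Pi _; rewrite /is_plateau ik.
under eq_bigr => i ik do rewrite sum_is_plateau //.
rewrite sum_nat_const.
(* The [n - k + 1] window positions contribute equally, and this factor turns one [(n - k)!] into
   [(n - k + 1)!]. *)
rewrite -(@eq_card _ [pred a : 'I_n | 0 <= a < n - k + 1]) => [|a]; last first.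
  by rewrite !inE unfold_in /=; lia.
rewrite card_ord_range; last lia.
by rewrite subn0 addn1 factS !mulnA.
Qed.
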